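(* Let $\mathfrak{O}=(D,\sqcup,\sqcap,\neg,\lrcorner,\top,\bot,\mathbf{I},\mathbf{C})$ be a dBao, and let $\mathbf{D}=(D,\sqcup,\sqcap,\neg,\lrcorner,\top,\bot)$ be its underlying dBa. Let $\mathbb{K}(\mathbf{D})$ and $\mathbb{KC}(\mathfrak{O})$ be the context and the Kripke context associated with $\mathfrak{O}$ (defined in the context field). Then the following hold. 1. $\mathfrak{O}$ is quasi-embeddable into the full complex algebra $\underline{\mathfrak{P}}^{+}(\mathbb{KC}(\mathfrak{O}))$ of the Kripke context $\mathbb{KC}(\mathfrak{O})$; the map $h:D\rightarrow \mathfrak{P}(\mathbb{K}(\mathbf{D}))$ defined by $h(x):=(F_{x},I_{x})$ for all $x\in D$ is such a quasi-embedding. 2. If $\mathfrak{O}$ is a contextual dBao, then the quasi-embedding $h$ is an embedding. 3. $\mathfrak{O}_{p}$ is embeddable into the largest pure subalgebra $\underline{\mathfrak{H}}^{+}(\mathbb{KC}(\mathfrak{O}))$ of $\underline{\mathfrak{P}}^{+}(\mathbb{KC}(\mathfrak{O}))$.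
   Context: **Double Boolean algebras.** A double Boolean algebra (dBa) is an algebra $\mathbf{D}=(D,\sqcup,\sqcap,\neg,\lrcorner,\top,\bot)$ such that, writing $x\vee y:=\neg(\neg x\sqcap\neg y)$ and $x\wedge y:=\lrcorner(\lrcorner x\sqcup\lrcorner y)$, for all $x,y,z\in D$: (1a) $(x\sqcap x)\sqcap y=x\sqcap y$; (1b) $(x\sqcup x)\sqcup y=x\sqcup y$; (2a) $x\sqcap y=y\sqcap x$; (2b) $x\sqcup y=y\sqcup x$; (3a) $x\sqcap(y\sqcap z)=(x\sqcap y)\sqcap z$; (3b) $x\sqcup(y\sqcup z)=(x\sqcup y)\sqcup z$; (4a) $\neg(x\sqcap x)=\neg x$; (4b) $\lrcorner(x\sqcup x)=\lrcorner x$; (5a) $x\sqcap(x\sqcup y)=x\sqcap x$; (5b) $x\sqcup(x\sqcap y)=x\sqcup x$; (6a) $x\sqcap(y\vee z)=(x\sqcap y)\vee(x\sqcap z)$; (6b) $x\sqcup(y\wedge z)=(x\sqcup y)\wedge(x\sqcup z)$; (7a) $x\sqcap(x\vee y)=x\sqcap x$; (7b) $x\sqcup(x\wedge y)=x\sqcup x$; (8a) $\neg\neg(x\sqcap y)=x\sqcap y$; (8b) $\lrcorner\lrcorner(x\sqcup y)=x\sqcup y$; (9a) $x\sqcap\neg x=\bot$; (9b) $x\sqcup\lrcorner x=\top$; (10a) $\neg\bot=\top\sqcap\top$; (10b) $\lrcorner\top=\bot\sqcup\bot$; (11a) $\neg\top=\bot$; (11b) $\lrcorner\bot=\top$; (12)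 $(x\sqcap x)\sqcup(x\sqcap x)=(x\sqcup x)\sqcap(x\sqcup x)$. The quasi-order of $\mathbf{D}$ is: $x\sqsubseteq y$ iff $x\sqcap y=x\sqcap x$ and $x\sqcup y=y\sqcup y$. $\mathbf{D}$ is contextual if $\sqsubseteq$ is a partial order, and pure if for each $x\in D$, $x\sqcap x=x$ or $x\sqcup x=x$. Put $D_\sqcap:=\{x: x\sqcap x=x\}$, $D_\sqcup:=\{x: x\sqcup x=x\}$, $D_p:=D_\sqcap\cup D_\sqcup$. It is known that $(D_\sqcap,\sqcap,\vee,\neg,\bot,\neg\bot)$ (meet $\sqcap$, join $\vee$, zero $\bot$, unit $\neg\bot$) and $(D_\sqcup,\sqcup,\wedge,\lrcorner,\top,\lrcorner\top)$ (join $\sqcup$, meet $\wedge$, unit $\top$, zero $\lrcorner\top$) are Boolean algebras, denoted $\mathbf{D}_\sqcap$, $\mathbf{D}_\sqcup$. **dBao.** A dBa with operators (dBao) is $\mathfrak{O}=(D,\sqcup,\sqcap,\neg,\lrcorner,\top,\bot,\mathbf{I},\mathbf{C})$ where the reduct without $\mathbf{I},\mathbf{C}$ is a dBa and $\mathbf{I},\mathbf{C}:D\to D$ are monotone with respect to $\sqsubseteq$ and satisfy, for all $x,y$: $\mathbf{I}(x\sqcap y)=\mathbf{I}(x)\sqcap\mathbf{I}(y)$, $\mathbf{C}(x\sqcup y)=\mathbf{C}(x)\sqcup\mathbf{C}(y)$, $\mathbf{I}(\neg\bot)=\neg\bot$, $\mathbf{C}(\lrcorner\top)=\lrcorner\top$,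 $\mathbf{I}(x\sqcap x)=\mathbf{I}(x)$, $\mathbf{C}(x\sqcup x)=\mathbf{C}(x)$. It is contextual (pure) if its underlying dBa is. Duals: $\mathbf{I}^\delta(a):=\neg\mathbf{I}(\neg a)$, $\mathbf{C}^\delta(a):=\lrcorner\mathbf{C}(\lrcorner a)$. $\mathfrak{O}_p$ denotes the subalgebra of $\mathfrak{O}$ with universe $D_p$. **Contexts and protoconcepts.** A context is $\mathbb{K}=(G,M,I)$ with $G,M$ sets and $I\subseteq G\times M$. For $A\subseteq G$, $A':=\{m\in M: gIm\text{ for all }g\in A\}$; for $B\subseteq M$, $B':=\{g\in G: gIm\text{ for all }m\in B\}$. A pair $(A,B)$ with $A\subseteq G$, $B\subseteq M$ is a protoconcept if $A''=B'$ (equivalently $A'=B''$), and a semiconcept if $A'=B$ or $B'=A$; $\mathfrak{P}(\mathbb{K})$, $\mathfrak{H}(\mathbb{K})$ are the sets of protoconcepts and semiconcepts, and $\mathfrak{H}(\mathbb{K})\subseteq\mathfrak{P}(\mathbb{K})$. Operations on $\mathfrak{P}(\mathbb{K})$: $(A_1,B_1)\sqcap(A_2,B_2):=(A_1\cap A_2,(A_1\cap A_2)')$, $(A_1,B_1)\sqcup(A_2,B_2):=((B_1\cap B_2)',B_1\cap B_2)$, $\neg(A,B):=(G\setminus A,(G\setminus A)')$, $\lrcorner(A,B):=((M\setminus B)',M\setminus B)$, $\top:=(G,\emptyset)$, $\bot:=(\emptyset,M)$. **Kripke contexts and complex algebras.** A Kripke context based on $\mathbb{K}=(G,M,I)$ is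 $\mathbb{KC}=((G,R),(M,S),I)$ with $R$, $S$ binary relations on $G$, $M$. For a binary relation $E$ on $W$ and $A\subseteq W$, $\underline{A}_E:=\{x\in W:\forall y\,(xEy\Rightarrow y\in A)\}$. For $(A,B)\in\mathfrak{P}(\mathbb{K})$, $f_R((A,B)):=(\underline{A}_R,(\underline{A}_R)')$ and $f_S((A,B)):=((\underline{B}_S)',\underline{B}_S)$. The full complex algebra is $\underline{\mathfrak{P}}^{+}(\mathbb{KC}):=(\mathfrak{P}(\mathbb{K}),\sqcup,\sqcap,\neg,\lrcorner,\top,\bot,f_R,f_S)$, and $\underline{\mathfrak{H}}^{+}(\mathbb{KC})$ is its subalgebra with universe $\mathfrak{H}(\mathbb{K})$. **The Kripke context of a dBao.** A filter of $\mathbf{D}$ is $F\subseteq D$ closed under $\sqcap$ and upward closed under $\sqsubseteq$; dually, an ideal is closed under $\sqcup$ and downward closed. $\mathcal{F}_p(\mathbf{D})$ is the set of filters $F$ of $\mathbf{D}$ with $F\cap D_\sqcap$ a prime filter of $\mathbf{D}_\sqcap$; $\mathcal{I}_p(\mathbf{D})$ is the set of ideals $J$ of $\mathbf{D}$ with $J\cap D_\sqcup$ a prime ideal of $\mathbf{D}_\sqcup$. For $x\in D$, $F_x:=\{F\in\mathcal{F}_p(\mathbf{D}):x\in F\}$, $I_x:=\{J\in\mathcal{I}_p(\mathbf{D}):x\in J\}$. $\mathbb{K}(\mathbf{D}):=(\mathcal{F}_p(\mathbf{D}),\mathcal{I}_p(\mathbf{D}),\Delta)$ with $F\Delta J$ iff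 $F\cap J=\emptyset$. $\mathbb{KC}(\mathfrak{O}):=((\mathcal{F}_p(\mathbf{D}),R),(\mathcal{I}_p(\mathbf{D}),S),\Delta)$ where $uRu_1$ iff $\mathbf{I}^\delta(a)\in u$ for all $a\in u_1$, and $vSv_1$ iff $\mathbf{C}^\delta(a)\in v$ for all $a\in v_1$. **Embeddings.** A homomorphism preserves all operations (including $\mathbf{I},\mathbf{C}$, which correspond to $f_R,f_S$). A quasi-embedding is a homomorphism $h$ with $x\sqsubseteq y$ iff $h(x)\sqsubseteq h(y)$ for all $x,y$. An embedding is an injective homomorphism.
   Formalization: The relation Δ is taken as ''F Δ J iff F∩J ≠ ∅'' instead of ''F∩J = ∅''; with disjointness h(x) = (F_x, I_x) need not be a protoconcept (e.g. the protoconcept algebra of ({g},{m},{(g,m)})), so the claim would be false. *)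

(* Defs.v *)
From Stdlib Require Relation_Definitions.
From mathcomp Require Import all_boot.
From mathcomp Require Import boolp classical_sets.

Set Implicit Arguments.
Unset Strict Implicit.
Unset Printing Implicit Defensive.

Local Open Scope classical_set_scope.

Declare Scope dba_scope.
Delimit Scope dba_scope with dba.
Local Open Scope dba_scope.

Reserved Notation "x ⊓ y" (at level 40, left associativity).
Reserved Notation "x ⊔ y" (at level 50, left associativity).
Reserved Notation "¬ x" (at level 35, right associativity).
Reserved Notation "⌟ x" (at level 35, right associativity).
Reserved Notation "x ⊑ y" (at level 70, no associativity).

Record dba_sig := DbaSig {
  dba_car :> Type;
  djoin : dba_car -> dba_car -> dba_car;
  dmeet : dba_car -> dba_car -> dba_car;
  dneg : dba_car -> dba_car;
  dopp : dba_car -> dba_car;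
  dtop : dba_car;
  dbot : dba_car }.

Arguments dtop {d}.
Arguments dbot {d}.

Notation "x ⊔ y" := (djoin x y) : dba_scope.
Notation "x ⊓ y" := (dmeet x y) : dba_scope.
Notation "¬ x" := (dneg x) : dba_scope.
Notation "⌟ x" := (dopp x) : dba_scope.

Definition dvee (A : dba_sig) (x y : A) : A := ¬ (¬ x ⊓ ¬ y).
Definition dwedge (A : dba_sig) (x y : A) : A := ⌟ (⌟ x ⊔ ⌟ y).

Record is_dBa (A : dba_sig) : Prop := IsDBa {
  dba1a : forall x y : A, (x ⊓ x) ⊓ y = x ⊓ y;
  dba1b : forall x y : A, (x ⊔ x) ⊔ y = x ⊔ y;
  dba2a : forall x y : A, x ⊓ y = y ⊓ x;
  dba2b : forall x y : A, x ⊔ y = y ⊔ x;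
  dba3a : forall x y z : A, x ⊓ (y ⊓ z) = (x ⊓ y) ⊓ z;
  dba3b : forall x y z : A, x ⊔ (y ⊔ z) = (x ⊔ y) ⊔ z;
  dba4a : forall x : A, ¬ (x ⊓ x) = ¬ x;
  dba4b : forall x : A, ⌟ (x ⊔ x) = ⌟ x;
  dba5a : forall x y : A, x ⊓ (x ⊔ y) = x ⊓ x;
  dba5b : forall x y : A, x ⊔ (x ⊓ y) = x ⊔ x;
  dba6a : forall x y z : A, x ⊓ dvee y z = dvee (x ⊓ y) (x ⊓ z);
  dba6b : forall x y z : A, x ⊔ dwedge y z = dwedge (x ⊔ y) (x ⊔ z);
  dba7a : forall x y : A, x ⊓ dvee x y = x ⊓ x;
  dba7b : forall x y : A, x ⊔ dwedge x y = x ⊔ x;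
  dba8a : forall x y : A, ¬ ¬ (x ⊓ y) = x ⊓ y;
  dba8b : forall x y : A, ⌟ ⌟ (x ⊔ y) = x ⊔ y;
  dba9a : forall x : A, x ⊓ ¬ x = dbot;
  dba9b : forall x : A, x ⊔ ⌟ x = dtop;
  dba10a : ¬ (dbot : A) = dtop ⊓ dtop;
  dba10b : ⌟ (dtop : A) = dbot ⊔ dbot;
  dba11a : ¬ (dtop : A) = dbot;
  dba11b : ⌟ (dbot : A) = dtop;
  dba12 : forall x : A, (x ⊓ x) ⊔ (x ⊓ x) = (x ⊔ x) ⊓ (x ⊔ x) }.

Definition dle (A : dba_sig) (x y : A) : Prop :=
  x ⊓ y = x ⊓ x /\ x ⊔ y = y ⊔ y.
Notation "x ⊑ y" := (dle x y) : dba_scope.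

Definition contextual (A : dba_sig) : Prop :=
  Relation_Definitions.order A (@dle A).

Definition Dmeet (A : dba_sig) : set A := [set x | x ⊓ x = x].
Definition Djoin (A : dba_sig) : set A := [set x | x ⊔ x = x].
Definition Dp (A : dba_sig) : set A := @Dmeet A `|` @Djoin A.
Arguments Dmeet : clear implicits.
Arguments Djoin : clear implicits.
Arguments Dp : clear implicits.

Definition pure (A : dba_sig) : Prop := forall x : A, x ⊓ x = x \/ x ⊔ x = x.

Record dbao_sig := DbaoSig {
  dbao_base :> dba_sig;
  opI : dbao_base -> dbao_base;
  opC : dbao_base -> dbao_base }.

Record is_dBao (A : dbao_sig) : Prop := IsDBao {
  dbao_dba : is_dBa A;
  opI_mono : forall x y : A, x ⊑ y -> opI x ⊑ opI y;
  opC_mono : forall x y : A, x ⊑ y -> opC x ⊑ opC y;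
  opI_meet : forall x y : A, opI (x ⊓ y) = opI x ⊓ opI y;
  opC_join : forall x y : A, opC (x ⊔ y) = opC x ⊔ opC y;
  opI_negbot : opI (¬ (dbot : A)) = ¬ dbot;
  opC_opptop : opC (⌟ (dtop : A)) = ⌟ dtop;
  opI_idem : forall x : A, opI (x ⊓ x) = opI x;
  opC_idem : forall x : A, opC (x ⊔ x) = opC x }.

Record dBao := DBao {
  dBao_sig :> dbao_sig;
  dBaoP : is_dBao dBao_sig }.

Definition Idual (A : dbao_sig) (a : A) : A := ¬ opI (¬ a).
Definition Cdual (A : dbao_sig) (a : A) : A := ⌟ opC (⌟ a).

Record homomorphism (A B : dbao_sig) (h : A -> B) : Prop := Homomorphism {
  hom_join : forall x y, h (x ⊔ y) = h x ⊔ h y;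
  hom_meet : forall x y, h (x ⊓ y) = h x ⊓ h y;
  hom_neg : forall x, h (¬ x) = ¬ h x;
  hom_opp : forall x, h (⌟ x) = ⌟ h x;
  hom_top : h dtop = dtop;
  hom_bot : h dbot = dbot;
  hom_I : forall x, h (opI x) = opI (h x);
  hom_C : forall x, h (opC x) = opC (h x) }.

Definition quasi_embedding (A B : dbao_sig) (h : A -> B) : Prop :=
  homomorphism h /\ forall x y, x ⊑ y <-> h x ⊑ h y.

Definition embedding (A B : dbao_sig) (h : A -> B) : Prop :=
  homomorphism h /\ injective h.

Record subuniverse (A : dbao_sig) (U : set A) : Prop := Subuniverse {
  sub_join : forall x y, U x -> U y -> U (x ⊔ y);
  sub_meet : forall x y, U x -> U y -> U (x ⊓ y);
  sub_neg : forall x, U x -> U (¬ x);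
  sub_opp : forall x, U x -> U (⌟ x);
  sub_top : U dtop;
  sub_bot : U dbot;
  sub_I : forall x, U x -> U (opI x);
  sub_C : forall x, U x -> U (opC x) }.

Section Subalgebra.
Variables (A : dbao_sig) (U : set A) (subU : subuniverse U).

Definition inU (x : A) (Ux : U x) : U := SigSub (mem_set Ux).

Definition subalgebra : dbao_sig :=
  @DbaoSig
    (@DbaSig U
       (fun x y => inU (sub_join subU (set_valP x) (set_valP y)))
       (fun x y => inU (sub_meet subU (set_valP x) (set_valP y)))
       (fun x => inU (sub_neg subU (set_valP x)))
       (fun x => inU (sub_opp subU (set_valP x)))
       (inU (sub_top subU)) (inU (sub_bot subU)))
    (fun x => inU (sub_I subU (set_valP x)))
    (fun x => inU (sub_C subU (set_valP x))).

End Subalgebra.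

Definition largest_pure_subuniverse (A : dbao_sig) (U : set A) : Prop :=
  (exists subU : subuniverse U, pure (subalgebra subU)) /\
  forall (V : set A) (subV : subuniverse V), pure (subalgebra subV) -> V `<=` U.

Section PurePart.
Variable O : dBao.
Let D : is_dBa O := dbao_dba (dBaoP O).

Lemma Dmeet_meet (x y : O) : Dmeet O (x ⊓ y).
Proof.
rewrite /Dmeet /= -(dba3a D x y) (dba2a D y (_ ⊓ _)) -(dba3a D x y y).
by rewrite (dba3a D) (dba1a D) (dba2a D) (dba1a D) (dba2a D).
Qed.

Lemma Djoin_join (x y : O) : Djoin O (x ⊔ y).
Proof.
rewrite /Djoin /= -(dba3b D x y) (dba2b D y (_ ⊔ _)) -(dba3b D x y y).
by rewrite (dba3b D) (dba1b D) (dba2b D) (dba1b D) (dba2b D).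
Qed.

Lemma Dmeet_neg (x : O) : Dmeet O (¬ x).
Proof.
by rewrite /Dmeet /= -(dba8a D) (dba4a D) -(dba4a D x) (dba8a D).
Qed.

Lemma Djoin_opp (x : O) : Djoin O (⌟ x).
Proof.
by rewrite /Djoin /= -(dba8b D) (dba4b D) -(dba4b D x) (dba8b D).
Qed.

Lemma Dp_subuniverse : subuniverse (Dp O).
Proof.
split.
- by move=> x y _ _; right; exact: Djoin_join.
- by move=> x y _ _; left; exact: Dmeet_meet.
- by move=> x _; left; exact: Dmeet_neg.
- by move=> x _; right; exact: Djoin_opp.
- by right; rewrite -(dba9b D dtop); exact: Djoin_join.
- by left; rewrite -(dba9a D dbot); exact: Dmeet_meet.
- by move=> x _; left; rewrite -(opI_idem (dBaoP O)) (opI_meet (dBaoP O));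
    exact: Dmeet_meet.
- by move=> x _; right; rewrite -(opC_idem (dBaoP O)) (opC_join (dBaoP O));
    exact: Djoin_join.
Qed.

Definition pure_part : dbao_sig := subalgebra Dp_subuniverse.

End PurePart.

Record context := Context {
  obj : Type;
  attr : Type;
  inc : obj -> attr -> Prop }.

Section Context.
Variable K : context.

Definition intent (A : set (obj K)) : set (attr K) :=
  [set m | forall g, A g -> inc g m].
Definition extent (B : set (attr K)) : set (obj K) :=
  [set g | forall m, B m -> inc g m].

Definition protoconcepts : set (set (obj K) * set (attr K)) :=
  [set p | extent (intent p.1) = extent p.2].
Definition semiconcepts : set (set (obj K) * set (attr K)) :=
  [set p | intent p.1 = p.2 \/ extent p.2 = p.1].

Lemma intentK A : intent (extent (intent A)) = intent A.
Proof.
apply/seteqP; split=> m /= Am g Ag; last exact: Ag.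
by apply: Am => n; apply.
Qed.

Lemma extentK B : extent (intent (extent B)) = extent B.
Proof.
apply/seteqP; split=> g /= Bg m Bm; last exact: Bm.
by apply: Bg => n; apply.
Qed.

Lemma protoconcept_intent A : protoconcepts (A, intent A).
Proof. by []. Qed.

Lemma protoconcept_extent B : protoconcepts (extent B, B).
Proof. by rewrite /protoconcepts /= extentK. Qed.

Lemma protoconcept_top : protoconcepts (setT, set0).
Proof.
by apply/seteqP; split=> g _ m // mT; exact: mT.
Qed.

Lemma protoconcept_bot : protoconcepts (set0, setT).
Proof.
rewrite /protoconcepts /=; suff -> : intent set0 = setT by [].
by apply/seteqP; split=> m // _ g.
Qed.

Definition of_extent (A : set (obj K)) : protoconcepts :=
  SigSub (mem_set (protoconcept_intent A)).
Definition of_intent (B : set (attr K)) : protoconcepts :=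
  SigSub (mem_set (protoconcept_extent B)).

Definition protoconcept_dba : dba_sig :=
  @DbaSig protoconcepts
    (fun p q => of_intent ((val p).2 `&` (val q).2))
    (fun p q => of_extent ((val p).1 `&` (val q).1))
    (fun p => of_extent (~` (val p).1))
    (fun p => of_intent (~` (val p).2))
    (SigSub (mem_set protoconcept_top))
    (SigSub (mem_set protoconcept_bot)).

End Context.

Arguments protoconcepts : clear implicits.

Record kripke_context := KripkeContext {
  kctx :> context;
  relG : obj kctx -> obj kctx -> Prop;
  relM : attr kctx -> attr kctx -> Prop }.

Definition lower_approx (W : Type) (E : W -> W -> Prop) (A : set W) : set W :=
  [set x | forall y, E x y -> A y].

Section ComplexAlgebra.
Variable KC : kripke_context.

Definition full_complex_algebra : dbao_sig :=
  @DbaoSig (protoconcept_dba KC)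
    (fun p => of_extent (lower_approx (@relG KC) (val p).1))
    (fun p => of_intent (lower_approx (@relM KC) (val p).2)).

Definition semiconcept_universe : set full_complex_algebra :=
  [set p : protoconcepts KC | semiconcepts (val p)].

Lemma semiconcept_subuniverse : subuniverse semiconcept_universe.
Proof.
split; rewrite /semiconcept_universe /semiconcepts /=; try by [left|right].
- by right; apply/seteqP; split=> g // _ m.
- by left; apply/seteqP; split=> m // _ g.
Qed.

Definition semiconcept_complex_algebra : dbao_sig :=
  subalgebra semiconcept_subuniverse.

End ComplexAlgebra.

Arguments semiconcept_universe : clear implicits.

(* [X] is the carrier of a Boolean algebra with operations [meet] and [join];
   its order is [x <= y] iff [meet x y = x], equivalently [join x y = y]. *)
Record bool_prime_filter (T : Type) (X : set T) (meet join : T -> T -> T)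
    (P : set T) : Prop := BoolPrimeFilter {
  bpf_sub : P `<=` X;
  bpf_neq0 : P !=set0;
  bpf_proper : P <> X;
  bpf_meet : forall x y, P x -> P y -> P (meet x y);
  bpf_up : forall x y, P x -> X y -> meet x y = x -> P y;
  bpf_prime : forall x y, X x -> X y -> P (join x y) -> P x \/ P y }.

Record bool_prime_ideal (T : Type) (X : set T) (meet join : T -> T -> T)
    (P : set T) : Prop := BoolPrimeIdeal {
  bpi_sub : P `<=` X;
  bpi_neq0 : P !=set0;
  bpi_proper : P <> X;
  bpi_join : forall x y, P x -> P y -> P (join x y);
  bpi_down : forall x y, P y -> X x -> meet x y = x -> P x;
  bpi_prime : forall x y, X x -> X y -> P (meet x y) -> P x \/ P y }.

Section StandardContext.
Variable A : dba_sig.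

Definition is_filter (F : set A) : Prop :=
  (forall x y, F x -> F y -> F (x ⊓ y)) /\
  (forall x y, F x -> x ⊑ y -> F y).

Definition is_ideal (J : set A) : Prop :=
  (forall x y, J x -> J y -> J (x ⊔ y)) /\
  (forall x y, J y -> x ⊑ y -> J x).

Definition Fp : set (set A) :=
  [set F | is_filter F /\
           bool_prime_filter (Dmeet A) (@dmeet A) (@dvee A) (F `&` Dmeet A)].

Definition Ip : set (set A) :=
  [set J | is_ideal J /\
           bool_prime_ideal (Djoin A) (@dwedge A) (@djoin A) (J `&` Djoin A)].

Definition Fset (x : A) : set Fp := [set F : Fp | val F x].
Definition Iset (x : A) : set Ip := [set J : Ip | val J x].

(* A filter and an ideal are incident when they meet, as in Wille's
   representation of double Boolean algebras.  With disjointness instead,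
   [(Fset x, Iset x)] would in general not be a protoconcept. *)
Definition standard_context : context :=
  @Context Fp Ip (fun F J => val F `&` val J !=set0).

End StandardContext.

Arguments Fp : clear implicits.
Arguments Ip : clear implicits.

Definition standard_kripke_context (A : dbao_sig) : kripke_context :=
  @KripkeContext (standard_context A)
    (fun u u1 : Fp A => forall a : A, val u1 a -> val u (Idual a))
    (fun v v1 : Ip A => forall a : A, val v1 a -> val v (Cdual a)).

(* Main.v *)
Require Import Defs.
From mathcomp Require Import all_boot.
From mathcomp Require Import boolp classical_sets.

(** A double Boolean algebra is a Stone-type gluing of two Boolean algebras, and
    the proof is the Jonsson-Tarski argument carried out on each of them.

    The members of [Fp] correspond to the ultrafilters of the Boolean algebra of
    meet-idempotents: a filter is determined by its meet-idempotent elements,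
    since it contains [x] exactly when it contains [x ⊓ x], and being prime
    means deciding negation ([FpP]). So [Fset] turns [⊓] into intersection and
    [¬] into complement, and a filter that misses an element can be enlarged,
    by Zorn's lemma, to a member of [Fp] that still misses it
    ([prime_filter_separation], [prime_filter_avoiding]). Applied to the filter
    of all [b] with [opI b] in [F], this is the usual canonical-model argument
    that [Fset] turns [opI] into the lower approximation ([opI_prime_filter]).

    Exchanging the two halves of the signature gives a double Boolean algebra
    again, whose filters are the ideals of the original one; hence every fact
    about filters holds for ideals ([dual_prime_filter]).

    The two halves are tied together by incidence. If [x] is meet-idempotent and
    a prime ideal does not contain [x], some prime filter through [x] is disjoint
    from it; this says that the intent of [Fset x] is [Iset x]
    ([intent_Fset]), and dually for the extent of a join-idempotent. Every
    operation other than the two constants returns an idempotent of the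
    appropriate kind, so its image is determined by one component, where the
    Boolean argument applies ([repr_homomorphism]).

    The order is reflected because prime filters separate the meet parts
    [x ⊓ x] and prime ideals separate the join parts [x ⊔ x] ([repr_dle]);
    contextuality is antisymmetry of the order, so it makes the map injective.
    On [Dp] antisymmetry always holds ([repr_inj_Dp]), and the image of an
    idempotent is a semiconcept by [intent_Fset] and its dual. *)

Set Implicit Arguments.
Unset Strict Implicit.
Unset Printing Implicit Defensive.

Local Open Scope classical_set_scope.
Local Open Scope dba_scope.

(** * The Boolean algebra of meet-idempotents *)

Section MeetPart.
Variables (A : dba_sig) (D : is_dBa A).
Implicit Types x y z : A.

Lemma dneg2 x : ¬ ¬ x = x ⊓ x.
Proof. by rewrite -(dba4a D x) (dba8a D). Qed.

Lemma Dmeet_dneg x : Dmeet A (¬ x).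
Proof. by rewrite /Dmeet /= -dneg2 (dneg2 x) (dba4a D). Qed.

Lemma Dmeet_dmeet x y : Dmeet A (x ⊓ y).
Proof. by rewrite -(dba8a D); exact: Dmeet_dneg. Qed.

Lemma dmeet_idr x y : x ⊓ (y ⊓ y) = x ⊓ y.
Proof. by rewrite (dba2a D) (dba1a D) (dba2a D). Qed.

Lemma dmeet_bot x : x ⊓ dbot = dbot.
Proof. by rewrite -(dba9a D x) (dba3a D) (dba1a D). Qed.

Lemma dmeet_top x : x ⊓ dtop = x ⊓ x.
Proof. by rewrite -(dba9b D x) (dba5a D). Qed.

Lemma dvee_idem x y : dvee (x ⊓ x) (y ⊓ y) = dvee x y.
Proof. by rewrite /dvee !(dba4a D). Qed.

Lemma dvee_absorb x y : dvee (x ⊓ x) (x ⊓ y) = x ⊓ x.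
Proof.
rewrite -{2}dmeet_top -(dmeet_idr x dtop) -(dba10a D).
have -> : ¬ dbot = dvee dtop y.
  by rewrite /dvee (dba11a D) (dba2a D) dmeet_bot.
by rewrite (dba6a D) dmeet_top.
Qed.

(** The two ways of reading the order of a Boolean algebra off its operations;
    the definitions of prime filter and prime ideal each use one of them. *)
Lemma dvee_eq_dmeet x y : Dmeet A x -> Dmeet A y ->
  dvee x y = x <-> y ⊓ x = y.
Proof.
move=> xD yD; split=> [xy|yx].
  by rewrite -xy /dvee (dba2a D (¬ x)) (dba7a D).
by have := dvee_absorb x y; rewrite (dba2a D x y) yx xD.
Qed.

Lemma dle_trans x y z : x ⊑ y -> y ⊑ z -> x ⊑ z.
Proof.
move=> [xy1 xy2] [yz1 yz2]; split.
  by rewrite -(dba1a D) -xy1 -(dba3a D) yz1 dmeet_idr.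
rewrite (dba2b D) -(dba1b D z x) (dba2b D _ x) -yz2 (dba3b D) xy2.
by rewrite (dba1b D) yz2.
Qed.

(** The second half of the quasi-order follows by absorption:
    [x ⊔ y = (x ⊓ y) ⊔ y = y ⊔ y]. *)
Lemma dle_Dmeet x y : Dmeet A x -> x ⊓ y = x -> x ⊑ y.
Proof.
move=> xD xy; split; first by rewrite xy xD.
by rewrite -{1}xy (dba2b D) (dba2a D x) (dba5b D).
Qed.

Lemma dle_dmeetl x y : x ⊓ y ⊑ x.
Proof.
apply: dle_Dmeet; first exact: Dmeet_dmeet.
by rewrite (dba2a D) (dba3a D) (dba1a D).
Qed.

Lemma dle_dmeetr x y : x ⊓ y ⊑ y.
Proof. by rewrite (dba2a D); exact: dle_dmeetl. Qed.

Lemma dmeet_glb x y z : Dmeet A x -> x ⊑ y -> x ⊑ z -> x ⊑ y ⊓ z.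
Proof.
move=> xD [xy _] [xz _]; apply: dle_Dmeet => //.
by rewrite (dba3a D) xy xD xz xD.
Qed.

Lemma dle_top x : x ⊑ dtop.
Proof.
split; first exact: dmeet_top.
have join_top y : y ⊔ dtop = dtop.
  by rewrite -[in LHS](dba9b D y) (dba3b D) (dba1b D) (dba9b D).
by rewrite !join_top.
Qed.

Lemma dle_bot x : dbot ⊑ x.
Proof.
apply: dle_Dmeet; first by rewrite -(dba11a D); exact: Dmeet_dneg.
by rewrite (dba2a D) dmeet_bot.
Qed.

(** This is what makes every ideal closed under the Boolean join, the hypothesis
    under which it can be separated from a filter. *)
Lemma dvee_le_djoin x y : dvee x y ⊑ x ⊔ y.
Proof.
apply: dle_Dmeet; first exact: Dmeet_dneg.
rewrite (dba2a D) (dba6a D) !(dba2a D (x ⊔ y)) (dba5a D).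
by rewrite (dba2b D) (dba5a D) dvee_idem.
Qed.

(** * Prime filters *)

(** A form of primeness that speaks of all elements, not only of the
    meet-idempotent ones, and that already implies that the filter is nonempty
    and proper. *)
Definition ultra (F : set A) : Prop :=
  is_filter F /\ forall x, F (¬ x) <-> ~ F x.

Lemma filter_dmeet (F : set A) x y :
  is_filter F -> F (x ⊓ y) <-> F x /\ F y.
Proof.
move=> [FM FU]; split=> [Fxy|[]]; last exact: FM.
by split; apply: FU Fxy _; [exact: dle_dmeetl|exact: dle_dmeetr].
Qed.

Lemma filter_top (F : set A) : is_filter F -> F !=set0 -> F dtop.
Proof. by move=> [_ FU] [x Fx]; apply: FU Fx _; exact: dle_top. Qed.

Lemma ultra_top (F : set A) : ultra F -> F dtop.
Proof.
move=> [Ff FN]; apply: filter_top => //.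
by have [?|/FN ?] := pselect (F dtop); eexists; eassumption.
Qed.

Lemma ultra_bot (F : set A) : ultra F -> ~ F dbot.
Proof.
by move=> FU; rewrite -(dba11a D); case: (FU) => _ -> /(_ (ultra_top FU)).
Qed.

Lemma FpP (F : set A) : Fp A F <-> ultra F.
Proof.
split=> [[Ff [_ F0 FT _ _ FP]]|FU].
  have [FM FUp] := Ff.
  have Fbot : ~ F dbot.
    move=> Fb; apply: FT; apply/seteqP; split=> [x [] //|x xD]; split=> //.
    by apply: FUp Fb _; exact: dle_bot.
  split=> // x; split=> [Fnx Fx|Fx].
    by apply: Fbot; rewrite -(dba9a D x); exact: FM.
  have Ft : F dtop by apply: filter_top => //; case: F0 => y [Fy _]; exists y.
  have Fxnx : (F `&` Dmeet A) (dvee (x ⊓ x) (¬ x)).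
    split; last exact: Dmeet_dneg.
    by rewrite /dvee (dba4a D) (dba9a D) (dba10a D); exact: FM.
  have [[/(filter_dmeet _ _ Ff)[] //]|[] //] :=
    FP _ _ (Dmeet_dmeet x x) (Dmeet_dneg x) Fxnx.
have [Ff FN] := FU; have [FM FUp] := Ff.
split=> //; split.
- by move=> x [].
- exists (dtop ⊓ dtop); split; last exact: Dmeet_dmeet.
  by apply/(filter_dmeet _ _ Ff); split; exact: ultra_top.
- move=> FE; apply: (ultra_bot FU); suff [] : (F `&` Dmeet A) dbot by [].
  by rewrite FE -(dba11a D); exact: Dmeet_dneg.
- move=> x y [Fx _] [Fy _]; split; [exact: FM|exact: Dmeet_dmeet].
- move=> x y [Fx xD] yD xy; split=> //; apply: FUp Fx _; exact: dle_Dmeet.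
- move=> x y xD yD [/FN Fxy _].
  have [Fx|/FN Fx] := pselect (F x); first by left.
  have [Fy|/FN Fy] := pselect (F y); first by right.
  by case: Fxy; exact: FM.
Qed.

(** By maximality, a filter [F] that avoids [J] and does not contain [x] has a
    member [f] with [f ⊓ x] in [J]; primeness then follows by distributivity.
    Only closure under the Boolean join [dvee] is asked of [J], because the set
    used in [prime_filter_avoiding] need not be closed under [⊔]. *)
Lemma prime_filter_separation (F0 J : set A) :
  is_filter F0 -> F0 !=set0 -> J !=set0 ->
  (forall x y, J y -> x ⊑ y -> J x) ->
  (forall x y, J x -> J y -> J (dvee x y)) ->
  F0 `&` J = set0 ->
  exists F, [/\ Fp A F, F0 `<=` F & F `&` J = set0].
Proof.
move=> F0f [x0 F0x] [j0 Jj] Jdown JV F0J.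
(* Requiring [F0] inside [G] only when [G] is nonempty lets the union of the
   empty chain belong to [P]. *)
pose P (G : set A) :=
  [/\ is_filter G, G `&` J = set0 & forall x, G x -> F0 `<=` G].
have [|F [[Ff FJ FF0] Fmax]] := @Zorn_bigcup A P.
  move=> C CP Ctot; split.
  - split=> [x y [X CX Xx] [Y CY Yy]|x y [X CX Xx] xy]; last first.
      by exists X => //; have [[_ XU] _ _] := CP _ CX; exact: XU Xx xy.
    have [XY|YX] := Ctot _ _ CX CY.
      by exists Y => //; have [[YM _] _ _] := CP _ CY; apply: YM => //; exact: XY.
    by exists X => //; have [[XM _] _ _] := CP _ CX; apply: XM => //; exact: YX.
  - apply/seteqP; split=> // x [[X CX Xx] Jx].
    by have [_ XJ _] := CP _ CX; rewrite -XJ.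
  - move=> x [X CX Xx] y F0y; exists X => //.
    by have [_ _ XF0] := CP _ CX; exact: XF0 Xx _ F0y.
have {}Fmax G : P G -> F `<=` G -> G `<=` F.
  move=> PG FG; apply: contrapT => GF; exact: (Fmax G).
have F0F : F0 `<=` F.
  have [[x Fx]|FN] := pselect (F !=set0); first exact: FF0 Fx.
  apply: Fmax => [|x Fx]; first by split=> // x _.
  by case: FN; exists x.
have ext x : ~ F x -> exists2 f, F f & J (f ⊓ x).
  move=> Fx; apply: contrapT => NJ; apply: Fx.
  have [FM FU] := Ff.
  (* [G] is the filter generated by [F] and [x]. *)
  pose G := [set z | exists2 f, F f & f ⊓ x ⊑ z].
  have FG : F `<=` G by move=> f Ff'; exists f => //; exact: dle_dmeetl.
  apply: (Fmax G _ FG).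
    split.
    - split=> [y z [f Ff' fy] [g Fg gz]|y z [f Ff' fy] yz]; last first.
        by exists f => //; exact: dle_trans fy yz.
      exists (f ⊓ g); first exact: FM.
      have fg_le h : f ⊓ g ⊑ h -> f ⊓ g ⊓ x ⊑ h ⊓ x.
        move=> fgh; apply: dmeet_glb; first exact: Dmeet_dmeet.
          by apply: dle_trans fgh; exact: dle_dmeetl.
        exact: dle_dmeetr.
      apply: dmeet_glb; first exact: Dmeet_dmeet.
        by apply: dle_trans fy; apply: fg_le; exact: dle_dmeetl.
      by apply: dle_trans gz; apply: fg_le; exact: dle_dmeetr.
    - apply/seteqP; split=> // z [[f Ff' fz] Jz].
      by apply: NJ; exists f => //; exact: Jdown Jz fz.
    - by move=> _ _ y F0y; apply: FG; exact: F0F.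
  by exists x0; [exact: F0F|exact: dle_dmeetr].
exists F; split=> //; have [FM FU] := Ff.
have NFJ x : F x -> J x -> False by move=> Fx Jx; rewrite -[False]/(set0 x) -FJ.
apply/FpP; split=> // x; split=> [Fnx Fx|Fx].
  apply: (NFJ (x ⊓ ¬ x)); first exact: FM.
  by rewrite (dba9a D); apply: Jdown Jj _; exact: dle_bot.
apply: contrapT => Fnx.
have [f Ff' Jf] := ext _ Fx; have [g Fg Jg] := ext _ Fnx.
apply: (NFJ (f ⊓ g ⊓ dvee x (¬ x))).
  have Ft : F dtop by apply: filter_top => //; exists f.
  by rewrite /dvee (dba9a D) (dba10a D); do !apply: (FM).
rewrite (dba6a D); apply: JV.
  by rewrite (dba2a D f) -(dba3a D); apply: Jdown Jf _; exact: dle_dmeetr.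
by rewrite -(dba3a D); apply: Jdown Jg _; exact: dle_dmeetr.
Qed.

(** Separation from the set of elements whose Boolean part lies below [y],
    which a filter meets only if it contains [y]. *)
Lemma prime_filter_avoiding (F0 : set A) y :
  is_filter F0 -> F0 !=set0 -> ~ F0 y ->
  exists F, [/\ Fp A F, F0 `<=` F & ~ F y].
Proof.
move=> F0f F0n F0y; have [F0M F0U] := F0f.
pose J := [set z : A | z ⊓ y = z ⊓ z].
have Jy : J y by [].
have [||||F [FF F0F FJ]] := @prime_filter_separation F0 J F0f F0n.
- by exists y.
- move=> x z Jz [xz _].
  by rewrite /J /= -(dba1a D) -xz -(dba3a D) Jz dmeet_idr xz.
- move=> x z Jx Jz; rewrite /J /= (dba2a D) (dba6a D) !(dba2a D y) Jx Jz dvee_idem.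
  by rewrite [RHS]Dmeet_dneg.
- apply/seteqP; split=> // x [F0x Jx]; apply: F0y.
  apply: (F0U (x ⊓ x)); first exact: F0M.
  by apply: dle_Dmeet; [exact: Dmeet_dmeet|rewrite (dba1a D)].
by exists F; split=> // Fy; rewrite -[False]/(set0 y) -FJ.
Qed.

Lemma principal_filter x : Dmeet A x -> is_filter [set z | x ⊑ z].
Proof.
by move=> xD; split=> [y z /= xy xz|y z /= xy]; [exact: dmeet_glb|exact: dle_trans].
Qed.

Lemma prime_filter_avoiding_ideal (J : set A) x :
  Dmeet A x -> is_ideal J -> J !=set0 -> ~ J x ->
  exists F, [/\ Fp A F, F x & F `&` J = set0].
Proof.
move=> xD [JJ Jdown] J0 NJx.
have [||||F [FF xF FJ]] :=
  @prime_filter_separation _ J (principal_filter xD) _ J0.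
- by exists x.
- by move=> y z Jz yz; exact: Jdown Jz yz.
- by move=> y z Jy Jz; apply: (Jdown _ (y ⊔ z)); [exact: JJ|exact: dvee_le_djoin].
- by apply/seteqP; split=> // z [xz Jz]; apply: NJx; exact: Jdown Jz xz.
by exists F; split=> //; exact: xF.
Qed.

Lemma dmeet_eq_of_prime_filters x y : Dmeet A x ->
  (forall F, Fp A F -> F x -> F y) -> x ⊓ y = x.
Proof.
move=> xD xy; apply: contrapT => Nxy.
have [||F [FF xF Fy]] := @prime_filter_avoiding _ y (principal_filter xD).
- by exists x.
- by move=> [+ _]; rewrite xD.
by apply: Fy; apply: xy => //; exact: xF.
Qed.

End MeetPart.

(** * The operator on prime filters *)

(** From left to right, apply the accessibility condition to [¬ x].
    From right to left, the set of all [b] with [opI b] in [F] is a filter, so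
    if it misses [x] it extends to a prime filter missing [x], and that prime
    filter is accessible from [F]. *)
Lemma opI_prime_filter (A : dbao_sig) (O : is_dBao A) (F : set A) (x : A) :
  Fp A F ->
  F (opI x) <->
  forall F1, Fp A F1 -> (forall a, F1 a -> F (Idual a)) -> F1 x.
Proof.
have D := dbao_dba O; move=> /(FpP D) FU; have [Ff FN] := FU.
split=> [FIx F1 /(FpP D)[_ F1N] R|FR].
  apply: contrapT => /F1N /R /FN; apply.
  by rewrite (dneg2 D) (opI_idem O).
apply: contrapT => NFx; pose B := [set b : A | F (opI b)].
have Bf : is_filter B.
  split=> [a b Ba Bb|a b Ba ab]; first by rewrite /B /= (opI_meet O); exact: (Ff.1).
  by apply: Ff.2 Ba _; exact: opI_mono.
have [||F1 [F1F BF1 F1x]] := @prime_filter_avoiding _ D B x Bf.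
- exists (¬ dbot); rewrite /B /= (opI_negbot O).
  by apply/FN; exact: ultra_bot FU.
- exact: NFx.
apply: F1x; apply: FR => // a F1a; apply/FN => FIna.
by have /(FpP D)[_ F1N] := F1F; have /F1N := BF1 _ FIna.
Qed.

(** * Duality *)

Definition dual_dba (A : dba_sig) : dba_sig :=
  @DbaSig A (@dmeet A) (@djoin A) (@dopp A) (@dneg A) dbot dtop.

Definition dual_dbao (A : dbao_sig) : dbao_sig :=
  @DbaoSig (dual_dba A) (@opC A) (@opI A).

Lemma dual_is_dBa (A : dba_sig) : is_dBa A -> is_dBa (dual_dba A).
Proof. by case=> *; split=> //= x; symmetry. Qed.

Section Dual.
Variables (A : dba_sig) (D : is_dBa A).

Lemma dual_dle (x y : A) : @dle (dual_dba A) x y <-> y ⊑ x.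
Proof.
rewrite /dle /= (dba2b D x) (dba2a D x).
by split=> -[].
Qed.

Lemma dual_filter (J : set A) : @is_filter (dual_dba A) J <-> is_ideal J.
Proof.
split=> -[JJ JU]; split=> // x y.
  by move=> Jy xy; apply: JU Jy _; apply/dual_dle.
by move=> Jx /dual_dle; exact: JU.
Qed.

Lemma dual_ideal (F : set A) : @is_ideal (dual_dba A) F <-> is_filter F.
Proof.
split=> -[FM FU]; split=> // x y.
  by move=> Fx xy; apply: FU Fx _; apply/dual_dle.
by move=> Fy /dual_dle; exact: FU.
Qed.

(** A prime filter is closed upwards for the order read off the Boolean meet.
    Dualizing a prime ideal yields the order read off the other operation, so
    the two have to be compared. *)
Lemma dual_prime_filter (J : set A) : Fp (dual_dba A) J <-> Ip A J.
Proof.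
have DD := dual_is_dBa D; rewrite /Fp /Ip /= dual_filter.
split=> -[Ji [sub n0 pr cl ud prm]]; split=> //; split=> //.
- move=> x y Py xD xy; apply: (ud y x) => //.
  exact: (dvee_eq_dmeet DD xD (sub _ Py)).1.
- move=> x y Px yD xy; apply: (ud y x) => //.
  exact: (dvee_eq_dmeet DD yD (sub _ Px)).2.
Qed.

End Dual.

Lemma dual_is_dBao (A : dbao_sig) : is_dBao A -> is_dBao (dual_dbao A).
Proof.
move=> O; have D := dbao_dba O; split; first exact: dual_is_dBa.
- by move=> x y /(dual_dle D) xy; apply/(dual_dle D); exact: opC_mono.
- by move=> x y /(dual_dle D) xy; apply/(dual_dle D); exact: opI_mono.
- exact: (opC_join O).
- exact: (opI_meet O).
- exact: (opC_opptop O).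
- exact: (opI_negbot O).
- exact: (opC_idem O).
- exact: (opI_idem O).
Qed.

(** * Intents and extents of basic sets *)

Section StandardContextMaps.
Variables (A : dba_sig) (D : is_dBa A).
Implicit Types x y : A.
Let DD := dual_is_dBa D.
Let K := standard_context A.

Lemma Fset_dmeet x y : Fset (x ⊓ y) = Fset x `&` Fset y.
Proof.
by apply/seteqP; split=> F; have [Ff _] := set_valP F; move/(filter_dmeet D _ _ Ff).
Qed.

Lemma Iset_djoin x y : Iset (x ⊔ y) = Iset x `&` Iset y.
Proof.
apply/seteqP; split=> J; have [/(dual_filter D) Ji _] := set_valP J;
by move/(filter_dmeet DD _ _ Ji).
Qed.

Lemma Fset_dneg x : Fset (¬ x) = ~` Fset x.
Proof.
by apply/seteqP; split=> F; have /(FpP D)[_ FN] := set_valP F; move/FN.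
Qed.

Lemma Iset_dopp x : Iset (⌟ x) = ~` Iset x.
Proof.
apply/seteqP; split=> J; have /(dual_prime_filter D)/(FpP DD)[_ JN] := set_valP J;
by move/JN.
Qed.

Lemma Fset_top : Fset (dtop : A) = setT.
Proof.
by apply/seteqP; split=> // F _; have /(FpP D) := set_valP F; exact: ultra_top.
Qed.

Lemma Fset_bot : Fset (dbot : A) = set0.
Proof. by rewrite -(dba11a D) Fset_dneg Fset_top setCT. Qed.

Lemma Iset_bot : Iset (dbot : A) = setT.
Proof.
apply/seteqP; split=> // J _.
by have /(dual_prime_filter D)/(FpP DD) := set_valP J; exact: (ultra_top DD).
Qed.

Lemma Iset_top : Iset (dtop : A) = set0.
Proof. by rewrite -(dba11b D) Iset_dopp Iset_bot setCT. Qed.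

(** The nontrivial inclusion holds since a prime ideal that does not contain the
    meet-idempotent [x] is disjoint from some prime filter through [x]. *)
Lemma intent_Fset x : Dmeet A x -> @intent K (Fset x) = Iset x.
Proof.
move=> xD; apply/seteqP; split=> J /= => [xJ|Jx F Fx]; last by exists x.
apply: contrapT => NJx.
have [Ji [_ [j [Jj _]] _ _ _ _]] := set_valP J.
have [|F [FF Fx FJ]] := prime_filter_avoiding_ideal D xD Ji _ NJx.
  by exists j.
have [z FJz] := xJ (SigSub (mem_set FF)) Fx.
by rewrite -[False]/(set0 z) -FJ.
Qed.

Lemma extent_Iset x : Djoin A x -> @extent K (Iset x) = Fset x.
Proof.
move=> xD; apply/seteqP; split=> F /= => [xF|Fx J Jx]; last by exists x.
apply: contrapT => NFx.
have [/(dual_ideal D) Ff [_ [f [Ff' _]] _ _ _ _]] := set_valP F.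
have [|J [/(dual_prime_filter D) JJ Jx JF]] :=
  prime_filter_avoiding_ideal DD xD Ff _ NFx.
  by exists f.
have [z [Fz Jz]] := xF (SigSub (mem_set JJ)) Jx.
by rewrite -[False]/(set0 z) -JF.
Qed.

(** Passing to the intent replaces [x] by [x ⊓ x], and passing to the extent
    replaces [x] by [x ⊔ x]; the protoconcept condition is therefore the mixed
    axiom [dba12], which says that the two replacements commute. *)
Lemma protoconcept_FIset x : protoconcepts K (Fset x, Iset x).
Proof.
rewrite /protoconcepts /=.
have -> : Fset x = Fset (x ⊓ x) by rewrite Fset_dmeet setIid.
have -> : Iset x = Iset (x ⊔ x) by rewrite Iset_djoin setIid.
rewrite (intent_Fset (Dmeet_dmeet D x x)).
rewrite (extent_Iset (Dmeet_dmeet DD x x : Djoin A (x ⊔ x))).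
have -> : Iset (x ⊓ x) = Iset ((x ⊓ x) ⊔ (x ⊓ x)) by rewrite Iset_djoin setIid.
rewrite extent_Iset; last exact: (Dmeet_dmeet DD (x ⊓ x) (x ⊓ x)).
by rewrite (dba12 D) Fset_dmeet setIid.
Qed.

Lemma Fset_subset x y : Fset x `<=` Fset y -> x ⊓ y = x ⊓ x.
Proof.
move=> xy; rewrite -(dba1a D).
apply: (dmeet_eq_of_prime_filters D (Dmeet_dmeet D x x)) => F FF.
move=> /(filter_dmeet D _ _ FF.1)[Fx _].
exact: (xy (SigSub (mem_set FF)) Fx).
Qed.

Lemma Iset_subset x y : Iset x `<=` Iset y -> x ⊔ y = x ⊔ x.
Proof.
move=> xy; rewrite -(dba1b D).
apply: (dmeet_eq_of_prime_filters DD (Dmeet_dmeet DD x x)) => J JJ.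
move=> /(filter_dmeet DD _ _ JJ.1)[Jx _].
have JI := (dual_prime_filter D J).1 JJ.
exact: (xy (SigSub (mem_set JI)) Jx).
Qed.

End StandardContextMaps.

(** * The representation *)

Section Representation.
Variables (A : dbao_sig) (O : is_dBao A).
Implicit Types x y : A.
Let D := dbao_dba O.
Let DD := dual_is_dBa D.
Let KC := standard_kripke_context A.

Lemma Fset_opI x : Fset (opI x) = lower_approx (@relG KC) (Fset x).
Proof.
apply/seteqP; split=> F /=; have FF := set_valP F.
  by move/(opI_prime_filter O _ FF) => FR F1 R; apply: FR (set_valP F1) R.
move=> FR; apply/(opI_prime_filter O _ FF) => F1 F1F R.
exact: (FR (SigSub (mem_set F1F))).
Qed.

Lemma Iset_opC x : Iset (opC x) = lower_approx (@relM KC) (Iset x).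
Proof.
have OD := dual_is_dBao O.
apply/seteqP; split=> J /=; have /(dual_prime_filter D) JJ := set_valP J.
  move/(opI_prime_filter OD _ JJ) => JR J1 R.
  by apply: JR => //; apply/(dual_prime_filter D); exact: (set_valP J1).
move=> JR; apply/(opI_prime_filter OD _ JJ) => J1 J1J R.
have J1I := (dual_prime_filter D J1).1 J1J.
exact: (JR (SigSub (mem_set J1I))).
Qed.

Definition repr x : full_complex_algebra KC :=
  SigSub (mem_set (protoconcept_FIset D x)).

Lemma repr_Dmeet x : Dmeet A x -> repr x = @of_extent KC (Fset x).
Proof. by move=> xD; apply: val_inj; rewrite /= intent_Fset. Qed.

Lemma repr_Djoin x : Djoin A x -> repr x = @of_intent KC (Iset x).
Proof. by move=> xD; apply: val_inj; rewrite /= extent_Iset. Qed.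

Lemma repr_homomorphism : homomorphism repr.
Proof.
split=> [x y|x y|x|x|||x|x].
- by rewrite repr_Djoin ?Iset_djoin //; exact: (Dmeet_dmeet DD x y).
- by rewrite repr_Dmeet ?Fset_dmeet //; exact: Dmeet_dmeet.
- by rewrite repr_Dmeet ?Fset_dneg //; exact: Dmeet_dneg.
- by rewrite repr_Djoin ?Iset_dopp //; exact: (Dmeet_dneg DD x).
- by apply: val_inj; rewrite /= Fset_top // Iset_top.
- by apply: val_inj; rewrite /= Fset_bot // Iset_bot.
- rewrite repr_Dmeet ?Fset_opI // -(opI_idem O) (opI_meet O).
  exact: Dmeet_dmeet.
- rewrite repr_Djoin ?Iset_opC // -(opC_idem O) (opC_join O).
  exact: (Dmeet_dmeet DD).
Qed.

Lemma repr_dle x y : x ⊑ y <-> repr x ⊑ repr y.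
Proof.
have [hJ hM _ _ _ _ _ _] := repr_homomorphism.
split=> [[xy1 xy2]|[]]; first by split; rewrite -?hM -?hJ ?xy1 ?xy2.
rewrite -!hM -!hJ => /(congr1 val) [+ _] /(congr1 val) [_].
rewrite !(Fset_dmeet D) !(Iset_djoin D) !setIid => xy yx; split.
  by apply: (Fset_subset D); rewrite -xy => F [].
rewrite (dba2b D); apply: (Iset_subset D).
by rewrite -yx => J [].
Qed.

(** Equal images force equal meet parts and equal join parts; if [x] and [y]
    are idempotent for different operations, the mixed axiom [dba12] identifies
    them. *)
Lemma repr_inj_Dp x y : Dp A x -> Dp A y -> repr x = repr y -> x = y.
Proof.
move=> xP yP /(congr1 val) [FE IE].
have M : x ⊓ x = y ⊓ y.
  rewrite -(Fset_subset D (_ : Fset x `<=` Fset y)); last by rewrite FE.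
  by rewrite (dba2a D) (Fset_subset D) // FE.
have J : x ⊔ x = y ⊔ y.
  rewrite -(Iset_subset D (_ : Iset x `<=` Iset y)); last by rewrite IE.
  by rewrite (dba2b D) (Iset_subset D) // IE.
case: xP yP => [xM|xJ] [yM|yJ].
- by rewrite -xM M.
- by have := dba12 D x; rewrite xM J yJ -M xM.
- by have := dba12 D y; rewrite yM -J xJ M yM.
- by rewrite -xJ J.
Qed.

End Representation.

(** A protoconcept is idempotent for [⊓] when its second component is the intent
    of the first, and for [⊔] when its first is the extent of the second; so the
    idempotents are exactly the semiconcepts. *)
Lemma semiconcept_largest_pure (KC : kripke_context) :
  largest_pure_subuniverse (semiconcept_universe KC).
Proof.
split.
  exists (semiconcept_subuniverse KC) => p.
  case: (set_valP p : semiconcepts _) => pE; [left|right];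
    apply: val_inj; apply: val_inj; rewrite /= setIid.
    by rewrite pE -surjective_pairing.
  by rewrite pE -surjective_pairing.
move=> V subV pV p Vp; rewrite /semiconcept_universe /semiconcepts /=.
by case: (pV (SigSub (mem_set Vp))) => /(congr1 (val \o val)) /= <-; [left|right].
Qed.

Theorem theorem20 (O : dBao) :
  (exists h : O -> full_complex_algebra (standard_kripke_context O),
    [/\ forall x : O, \val (h x) = (Fset x, Iset x),
        quasi_embedding h
      & contextual O -> embedding h]) /\
  (largest_pure_subuniverse
     (semiconcept_universe (standard_kripke_context O)) /\
   exists k : pure_part O ->
              semiconcept_complex_algebra (standard_kripke_context O),
     embedding k).
Proof.
have P := dBaoP O; have D := dbao_dba P; have hh := repr_homomorphism P.
split.
  exists (repr P); split=> // [|[_ _ anti]].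
    by split=> // x y; exact: repr_dle.
  split=> // x y xy; apply: anti; apply/(repr_dle P); rewrite xy.
    by split.
  by split.
split; first exact: semiconcept_largest_pure.
have semi (x : pure_part O) : semiconcept_universe _ (repr P (val x)).
  have [xM|xJ] := set_valP x; [left|right]; first exact: intent_Fset.
  exact: extent_Iset.
exists (fun x => inU (semi x)); split; last first.
  move=> x y /(congr1 val) /= xy; apply: val_inj.
  by apply: (repr_inj_Dp (set_valP x) (set_valP y) xy).
by case: hh => *; split=> *; apply: val_inj => /=.
Qed.
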